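(* Let $d,r\ge2$ and $e\ge1$. The reflection group $G(de,e,r)$ is isomorphic to the semidirect product $C_d^e\ltimes G(de,de,r)$, where $C_d^e=\langle z\rangle$ is a cyclic group of order $d$ acting on $G(de,de,r)$ by $zt_iz^{-1}=t_{i-e}$ for $i\in\mathbb{Z}/de$ and $zs_jz^{-1}=s_j$ for $3\le j\le r$. Hence $G(de,e,r)$ has the following presentation. Generators: $\{z\}\cup T_{de}\cup S$ where $T_{de}=\{t_i\mid i\in\mathbb{Z}/de\}$ and $S=\{s_j\mid 3\le j\le r\}$. Relations: - the relations of $G(de,de,r)$: the usual braid relations on $S$; $t_it_{i-1}=t_jt_{j-1}$ for $i,j\in\mathbb{Z}/de$; $s_3t_is_3=t_is_3t_i$ for $i\in\mathbb{Z}/de$; $s_jt_i=t_is_j$ for $i\in\mathbb{Z}/de$ and $4\le j\le r$; - $zt_i=t_{i-e}z$ and $zs_j=s_jz$ for $i\in\mathbb{Z}/de$ and $3\le j\le r$; - $z^d=1$, $t_i^2=1$ and $s_j^2=1$ for $i\in\mathbb{Z}/de$ and $3\le j\le r$.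
   Context: For positive integers $d,e,r$, $G(de,e,r)$ is the group of $r\times r$ monomial matrices whose nonzero entries are $de$-th roots of unity and such that the $d$-th power of the product of the nonzero entries equals $1$. (In particular $G(de,de,r)$ is obtained by replacing $(d,e)$ with $(1,de)$.) The usual braid relations on $S=\{s_3,\ldots,s_r\}$ are $s_is_j=s_js_i$ for $|i-j|\ge 2$ and $s_is_{i+1}s_i=s_{i+1}s_is_{i+1}$ for $3\le i\le r-1$. If $r=2$ then $S=\emptyset$ and all relations involving some $s_j$ are absent. For $n\ge2$, by a theorem of Corran–Picantin, $G(n,n,r)$ is presented by generators $t_i$ ($i\in\mathbb{Z}/n$), $s_3,\ldots,s_r$ with relations: the usual braid relations on $S$, $t_it_{i-1}=t_jt_{j-1}$, $s_3t_is_3=t_is_3t_i$, $s_jt_i=t_is_j$ ($4\le j\le r$) for $i,j$ in the indicated ranges, and $a^2=1$ for all generators $a$. Here $t_i$ corresponds to the matrix $\begin{pmatrix}0&\zeta_n^{-i}\\ \zeta_n^i&0\end{pmatrix}\oplus I_{r-2}$, with $\zeta_n$ a primitive $n$-th root of unity, and $s_j$ to the permutation matrix of $(j-1\ \ j)$. In $G(de,e,r)$ the generator $z$ corresponds to $\operatorname{Diag}(\zeta_{de}^e,1,\ldots,1)$. *)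

(* Defs.v *)
From HB Require Import structures.
From mathcomp Require Import all_boot all_order all_fingroup all_algebra.
Set Implicit Arguments.
Unset Strict Implicit.
Unset Printing Implicit Defensive.
Import Order.TTheory GRing.Theory Num.Theory.

Local Open Scope group_scope.

(* A letter (x, false) stands for the generator x and (x, true) for its
   formal inverse. *)
Definition word (X : Type) := seq (X * bool).

Definition pos_word (X : Type) (w : seq X) : word X :=
  [seq (x, false) | x <- w].

Definition eval_word (X : Type) (G : groupType) (f : X -> G) (w : word X) : G :=
  \prod_(l <- w) (if l.2 then (f l.1)^-1 else f l.1).

(* Equality in the abstract group < X | u = v for R u v >: the smallest
   congruence on words containing R and free cancellation. *)
Inductive word_eq (X : Type) (R : word X -> word X -> Prop) :
    word X -> word X -> Prop :=
| word_eq_rel u v of R u v : word_eq R u v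
| word_eq_cancel x b : word_eq R [:: (x, b); (x, ~~ b)] [::]
| word_eq_refl u : word_eq R u u
| word_eq_sym u v of word_eq R u v : word_eq R v u
| word_eq_trans u v w of word_eq R u v & word_eq R v w : word_eq R u w
| word_eq_cat u u' v v' of word_eq R u u' & word_eq R v v' :
    word_eq R (u ++ v) (u' ++ v').

(* The homomorphism < X | R > -> G induced by f exists and is bijective. *)
Definition presents (X : Type) (R : word X -> word X -> Prop) (G : groupType)
    (f : X -> G) : Prop :=
  (forall g : G, exists w, eval_word f w = g) /\
  (forall u v, word_eq R u v <-> eval_word f u = eval_word f v).

(* Left actions by automorphisms. The semidirect products in the library
   are restricted to finite group types, whence the versions below. *)
Record aut_lact (H N : groupType) := AutLact {
  aut_lact_fun :> H -> N -> N;
  aut_lact1 : forall x, aut_lact_fun 1 x = x;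
  aut_lactM : forall g h x,
    aut_lact_fun (g * h) x = aut_lact_fun g (aut_lact_fun h x);
  aut_lact_mul : forall g x y,
    aut_lact_fun g (x * y) = aut_lact_fun g x * aut_lact_fun g y
}.

(* The pair (x, h) stands for the product x h, with h x h^-1 = a h x. *)
Record semidirect (H N : groupType) (a : aut_lact H N) :=
  SemiDirect { sd_ker : N; sd_cpl : H }.
Arguments SemiDirect {H N} a sd_ker sd_cpl.

Section SemiDirectGroup.
Variables (H N : groupType) (a : aut_lact H N).

Definition sd_pair (u : semidirect a) : N * H := (sd_ker u, sd_cpl u).
Definition sd_of_pair (p : N * H) : semidirect a := SemiDirect a p.1 p.2.
Lemma sd_pairK : cancel sd_pair sd_of_pair. Proof. by case. Qed.

HB.instance Definition _ := Choice.copy (semidirect a) (can_type sd_pairK).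

Definition sd_one := SemiDirect a 1 1.
Definition sd_mul (u v : semidirect a) :=
  SemiDirect a (sd_ker u * a (sd_cpl u) (sd_ker v)) (sd_cpl u * sd_cpl v).
Definition sd_inv (u : semidirect a) :=
  SemiDirect a (a (sd_cpl u)^-1 (sd_ker u)^-1) (sd_cpl u)^-1.

Lemma aut_lact_one h : a h 1 = 1.
Proof. by apply: (mulgI (a h 1)); rewrite -aut_lact_mul !mulg1. Qed.

Lemma sd_mulA : associative sd_mul.
Proof.
case=> [x g] [y h] [w k]; rewrite /sd_mul /=.
by rewrite aut_lact_mul -aut_lactM !mulgA.
Qed.

Lemma sd_mul1 : left_id sd_one sd_mul.
Proof. by case=> x g; rewrite /sd_mul /= aut_lact1 !mul1g. Qed.

Lemma sd_mulr1 : right_id sd_one sd_mul.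
Proof. by case=> x g; rewrite /sd_mul /= aut_lact_one !mulg1. Qed.

Lemma sd_mulV : left_inverse sd_one sd_inv sd_mul.
Proof.
by case=> x g; rewrite /sd_mul /sd_inv /= -aut_lact_mul !mulVg aut_lact_one.
Qed.

Lemma sd_mulrV : right_inverse sd_one sd_inv sd_mul.
Proof.
by case=> x g; rewrite /sd_mul /sd_inv /= -aut_lactM !mulgV aut_lact1 mulgV.
Qed.

HB.instance Definition _ := isGroup.Build (semidirect a)
  sd_mulA sd_mul1 sd_mulr1 sd_mulV sd_mulrV.

End SemiDirectGroup.

Local Open Scope ring_scope.

Definition monomial_mx (C : numClosedFieldType) (r : nat) (A : 'M[C]_r) : bool :=
  [forall i, #|[set j | A i j != 0]| == 1%N] &&
  [forall j, #|[set i | A i j != 0]| == 1%N].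

Definition in_refl (C : numClosedFieldType) (d e r : nat) (A : 'M[C]_r) : bool :=
  [&& monomial_mx A,
      [forall i, forall j, (A i j != 0) ==> (A i j ^+ (d * e) == 1)]
    & (\prod_i \prod_(j | A i j != 0) A i j) ^+ d == 1].

(* refl_group C d e r is G(de,e,r); in particular G(de,de,r) is
   refl_group C 1 (d * e) r. *)
Definition refl_group (C : numClosedFieldType) (d e r : nat) :=
  {A : 'M[C]_r | in_refl d e A}.

Section ReflGroup.
Variables (C : numClosedFieldType) (d e r : nat).

HB.instance Definition _ := Choice.on (refl_group C d e r).
HB.instance Definition _ := SubType.on (refl_group C d e r).

Definition mono_mx (s : 'S_r) (v : 'I_r -> C) : 'M[C]_r :=
  \matrix_(i, j) (if s i == j then v i else 0).

Lemma in_reflP (A : 'M[C]_r) :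
  reflect (exists s v, [/\ forall i, v i != 0, forall i, v i ^+ (d * e) = 1,
                           (\prod_i v i) ^+ d = 1 & A = mono_mx s v])
          (in_refl d e A).
Proof.
apply: (iffP and3P) => [[/andP[/forallP rowA /forallP colA] rootA prodA]|].
  have ex i : {j | [set j | A i j != 0] = [set j]}.
    have : exists j, [set j | A i j != 0] == [set j].
      by have /cards1P[j ->] := rowA i; exists j.
    by case/sigW=> j /eqP; exists j.
  pose f i := sval (ex i).
  have fP i j : (A i j != 0) = (f i == j).
    by have /setP/(_ j) := svalP (ex i); rewrite !inE [f i == j]eq_sym.
  have f_inj : injective f.
    move=> i i' eqf; have /cards1P[k /setP colk] := colA (f i).
    have := colk i; rewrite !inE fP eqxx => /esym/eqP->.
    by have := colk i'; rewrite !inE fP eqf eqxx => /esym/eqP->.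
  exists (perm f_inj), (fun i => A i (f i)); split=> [i|i||].
  - by rewrite fP.
  - have /forallP/(_ (f i)) := forallP rootA i.
    by rewrite fP eqxx => /eqP.
  - rewrite -[RHS](eqP prodA); congr (_ ^+ _); apply: eq_bigr => i _.
    by rewrite (big_pred1 (f i)) // => j; rewrite fP eq_sym.
  - apply/matrixP=> i j; rewrite mxE permE; have := fP i j.
    by case: (f i =P j) => [<- //|_ /negbFE/eqP].
case=> s [v [v_neq0 rootv prodv ->]].
have E i j : (mono_mx s v i j != 0) = (s i == j).
  by rewrite mxE; case: (s i == j); rewrite ?eqxx ?v_neq0.
split.
- apply/andP; split; apply/forallP=> i; apply/cards1P.
    by exists (s i); apply/setP=> j; rewrite !inE E eq_sym.
  by exists ((s^-1)%g i); apply/setP=> j; rewrite !inE E (canF_eq (permK s)).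
- apply/forallP=> i; apply/forallP=> j; rewrite E; apply/implyP => sij.
  by rewrite mxE sij rootv.
- rewrite -[X in _ == X]prodv; apply/eqP; congr (_ ^+ _).
  apply: eq_bigr => i _.
  rewrite (big_pred1 (s i)) => [|j]; first by rewrite mxE eqxx.
  by rewrite E eq_sym.
Qed.

Lemma mono_mx1 : mono_mx 1%g (fun=> 1) = 1%:M.
Proof. by apply/matrixP=> i j; rewrite !mxE perm1; case: eqP. Qed.

Lemma mono_mxM s v s' v' :
  mono_mx s v *m mono_mx s' v' = mono_mx (s * s')%g (fun i => v i * v' (s i)).
Proof.
apply/matrixP=> i j; rewrite !mxE (bigD1 (s i)) //= !mxE eqxx permM.
rewrite big1 => [|k]; last first.
  by rewrite mxE eq_sym => /negPf->; rewrite mul0r.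
by rewrite addr0; case: eqP; rewrite ?mulr0.
Qed.

Lemma in_refl1 : in_refl d e (1%:M : 'M[C]_r).
Proof.
apply/in_reflP; exists 1%g, (fun=> 1); split=> [i|i||]; last 1 first.
- by rewrite mono_mx1.
- exact: oner_neq0.
- by rewrite expr1n.
- by rewrite big1 ?expr1n.
Qed.

Lemma in_reflM (A B : 'M[C]_r) :
  in_refl d e A -> in_refl d e B -> in_refl d e (A *m B).
Proof.
move=> /in_reflP[s [v [v0 rv pv ->]]] /in_reflP[s' [v' [v0' rv' pv' ->]]].
rewrite mono_mxM; apply/in_reflP; exists (s * s')%g, (fun i => v i * v' (s i)).
split=> // [i|i|]; first by rewrite mulf_neq0.
  by rewrite exprMn rv rv' mulr1.
rewrite big_split exprMn pv mul1r.
by rewrite -[RHS]pv' [in RHS](reindex_inj (@perm_inj _ s)).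
Qed.

Lemma mono_mxV s v : (forall i, v i != 0) ->
  mono_mx s v *m mono_mx s^-1%g (fun i => (v ((s^-1)%g i))^-1) = 1%:M.
Proof.
move=> v0; rewrite mono_mxM mulgV -mono_mx1.
by apply/matrixP=> i j; rewrite !mxE permK mulfV.
Qed.

Lemma in_refl_unit (A : 'M[C]_r) : in_refl d e A -> A \in unitmx.
Proof.
by case/in_reflP=> s [v [v0 _ _ ->]]; case: (mulmx1_unit (mono_mxV s v0)).
Qed.

Lemma in_reflV (A : 'M[C]_r) : in_refl d e A -> in_refl d e (invmx A).
Proof.
move=> inA; have uA := in_refl_unit inA.
case/in_reflP: inA => s [v [v0 rv pv defA]].
have -> : invmx A = mono_mx s^-1%g (fun i => (v ((s^-1)%g i))^-1).
  rewrite -[RHS]mul1mx -(mulVmx uA) -mulmxA.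
  by rewrite [X in _ *m (X *m _)]defA mono_mxV // mulmx1.
apply/in_reflP; eexists _, _; split; last by [].
- by move=> i; rewrite invr_neq0.
- by move=> i; rewrite exprVn rv invr1.
- rewrite prodfV exprVn; apply/eqP; rewrite invr_eq1; apply/eqP; rewrite -[RHS]pv.
  by rewrite [in RHS](reindex_inj (@perm_inj _ s^-1%g)).
Qed.

Definition refl_one : refl_group C d e r := Sub 1%:M in_refl1.
Definition refl_mul (A B : refl_group C d e r) : refl_group C d e r :=
  Sub (val A *m val B) (in_reflM (valP A) (valP B)).
Definition refl_inv (A : refl_group C d e r) : refl_group C d e r :=
  Sub (invmx (val A)) (in_reflV (valP A)).

Lemma refl_mulA : associative refl_mul.
Proof. by move=> A B D; apply: val_inj; rewrite /= mulmxA. Qed.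
Lemma refl_mul1 : left_id refl_one refl_mul.
Proof. by move=> A; apply: val_inj; rewrite /= mul1mx. Qed.
Lemma refl_mulr1 : right_id refl_one refl_mul.
Proof. by move=> A; apply: val_inj; rewrite /= mulmx1. Qed.
Lemma refl_mulV : left_inverse refl_one refl_inv refl_mul.
Proof.
by move=> A; apply: val_inj; rewrite /= mulVmx // (in_refl_unit (valP A)).
Qed.
Lemma refl_mulrV : right_inverse refl_one refl_inv refl_mul.
Proof.
by move=> A; apply: val_inj; rewrite /= mulmxV // (in_refl_unit (valP A)).
Qed.

HB.instance Definition _ := isGroup.Build (refl_group C d e r)
  refl_mulA refl_mul1 refl_mulr1 refl_mulV refl_mulrV.

End ReflGroup.

Definition s_index (r : nat) := {j : nat | 3 <= j <= r}%N.

Lemma s_index_lt1 r (j : s_index r) : (val j - 2 < r)%N.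
Proof.
case: j => j /= /andP[j3 jr]; apply: leq_trans jr.
by rewrite ltn_subrL (leq_trans _ j3).
Qed.
Lemma s_index_lt2 r (j : s_index r) : (val j - 1 < r)%N.
Proof.
case: j => j /= /andP[j3 jr]; apply: leq_trans jr.
by rewrite ltn_subrL (leq_trans _ j3).
Qed.

(* Rows and columns are numbered from 0 here, so that the transposition
   (j-1 j) exchanges the ordinals j-2 and j-1. *)
Definition s_mx (C : numClosedFieldType) (r : nat) (j : s_index r) : 'M[C]_r :=
  tperm_mx (Ordinal (s_index_lt1 j)) (Ordinal (s_index_lt2 j)).

(* The 2 x 2 block with rows (0, zeta^-i) and (zeta^i, 0), completed by the
   identity; only meant for zeta ^+ n = 1 and r >= 2. *)
Definition t_mx (C : numClosedFieldType) (r n : nat) (zeta : C) (i : 'Z_n) :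
    'M[C]_r :=
  \matrix_(a, b)
    match nat_of_ord a, nat_of_ord b with
    | 0, 1 => zeta ^- i
    | 1, 0 => zeta ^+ i
    | 0, 0 | 1, 1 => 0
    | _, _ => (a == b)%:R
    end.

Definition z_mx (C : numClosedFieldType) (r e : nat) (zeta : C) : 'M[C]_r :=
  diag_mx (\row_a (if a == 0%N :> nat then zeta ^+ e else 1)).

Inductive refl_gen (n r : nat) := Gz | Gt of 'Z_n | Gs of s_index r.
Arguments Gz {n r}.
Arguments Gt {n r} i.
Arguments Gs {n r} j.

Definition gen_mx (C : numClosedFieldType) (d e r : nat) (zeta : C)
    (x : refl_gen (d * e) r) : 'M[C]_r :=
  match x with
  | Gz => z_mx r e zeta
  | Gt i => t_mx r zeta i
  | Gs j => s_mx C j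
  end.

Inductive positive_rel (d e r : nat) :
    seq (refl_gen (d * e) r) -> seq (refl_gen (d * e) r) -> Prop :=
| rel_comm (j k : s_index r) of (val j + 2 <= val k)%N || (val k + 2 <= val j)%N :
    positive_rel [:: Gs j; Gs k] [:: Gs k; Gs j]
| rel_braid (j k : s_index r) of val k = (val j).+1 :
    positive_rel [:: Gs j; Gs k; Gs j] [:: Gs k; Gs j; Gs k]
| rel_tt (i j : 'Z_(d * e)) :
    positive_rel [:: Gt i; Gt (i - 1)] [:: Gt j; Gt (j - 1)]
| rel_s3t (j : s_index r) (i : 'Z_(d * e)) of val j = 3%N :
    positive_rel [:: Gs j; Gt i; Gs j] [:: Gt i; Gs j; Gt i]
| rel_st (j : s_index r) (i : 'Z_(d * e)) of (4 <= val j)%N :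
    positive_rel [:: Gs j; Gt i] [:: Gt i; Gs j]
| rel_zt (i : 'Z_(d * e)) :
    positive_rel [:: Gz; Gt i] [:: Gt (i - e%:R); Gz]
| rel_zs (j : s_index r) : positive_rel [:: Gz; Gs j] [:: Gs j; Gz]
| rel_z_ord : positive_rel (nseq d Gz) [::]
| rel_t_ord (i : 'Z_(d * e)) : positive_rel [:: Gt i; Gt i] [::]
| rel_s_ord (j : s_index r) : positive_rel [:: Gs j; Gs j] [::].

Definition refl_rel (d e r : nat) (u v : word (refl_gen (d * e) r)) : Prop :=
  exists u' v', [/\ positive_rel u' v', u = pos_word u' & v = pos_word v'].

(* Main.v *)
Require Import Defs.
From HB Require Import structures.
From mathcomp Require Import all_boot all_order all_fingroup all_algebra.
From mathcomp Require Import boolp zify.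
Set Implicit Arguments.
Unset Strict Implicit.
Unset Printing Implicit Defensive.
Import Order.TTheory GRing.Theory Num.Theory.

(* The matrices satisfy the relations, so the presented group P maps to
   G(de,e,r); bijectivity is a coset enumeration along the chain
   G(de,e,1) < G(de,e,2) < ... < G(de,e,r).  Writing u_m = s_3 ... s_m, the
   relations alone show that each element of the subgroup P_m of P generated by
   z, the t_i and s_3, ..., s_m is c h with h in P_(m-1) and c one of
   t_k u_m, u_j^-1 t_k t_0 u_m (2 <= j <= m).  As P_(m-1) fixes the basis
   vector e_m while the c map it to the pairwise distinct vectors zeta^-k e_1
   and zeta^k e_j, which exhaust the orbit of e_m under G(de,e,m), injectivity
   and surjectivity of P_m -> G(de,e,m) follow by induction on m from the case
   of the cyclic group <z>.

   For the semidirect product, the product of the nonzero entries is a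
   homomorphism from G(de,e,r) onto the group of d-th roots of unity, its
   kernel is G(de,de,r), and it maps <z> isomorphically onto its image. *)

(** * The group defined by a presentation *)

Section PresentedGroup.
Local Open Scope group_scope.
Local Open Scope quotient_scope.
Variables (X : Type) (R : word X -> word X -> Prop).

(** As [X] is an arbitrary type and [word_eq] lives in [Prop], [{classic _}] supplies the choice
    structure and [asbool] the boolean relation that the quotient requires. *)
Lemma word_eq_equiv : equiv_class_of (fun u v : {classic word X} =>
  `[< word_eq R u v >]).
Proof.
split=> [u|u v|v u w].
- by apply/asboolP; apply: word_eq_refl.
- by apply/asboolP/asboolP; apply: word_eq_sym.
- by move=> /asboolP uv /asboolP vw; apply/asboolP; apply: word_eq_trans uv vw.
Qed.

Canonical word_equiv := EquivRelPack word_eq_equiv.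

Definition pres_group := {eq_quot word_equiv}.
HB.instance Definition _ := Choice.on pres_group.

Definition wclass (w : word X) : pres_group := \pi_pres_group w.

Definition wrepr (q : pres_group) : word X := generic_quotient.repr q.

Lemma wclassP u v : wclass u = wclass v <-> word_eq R u v.
Proof.
rewrite /wclass; split=> [/eqmodP/asboolP //|uv].
by apply/eqmodP/asboolP.
Qed.

Lemma wreprK (q : pres_group) : wclass (wrepr q) = q.
Proof. exact: reprK. Qed.

Lemma wrepr_wclass w : word_eq R (wrepr (wclass w)) w.
Proof. by apply/wclassP; rewrite wreprK. Qed.

Definition word_inv (w : word X) : word X := rev [seq (l.1, ~~ l.2) | l <- w].

Lemma word_invr w : word_eq R (w ++ word_inv w) [::].
Proof.
elim: w => [|[x b] w IHw]; first exact: word_eq_refl.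
rewrite /word_inv /= rev_cons -cats1 catA -/(word_inv w).
apply: word_eq_trans (word_eq_cancel R x b).
apply: (@word_eq_cat _ R [:: (x, b)] [:: (x, b)] _ [:: (x, ~~ b)]).
  exact: word_eq_refl.
apply: (@word_eq_cat _ R _ [::] [:: (x, ~~ b)] [:: (x, ~~ b)]) => //.
exact: word_eq_refl.
Qed.

Lemma word_invK : involutive word_inv.
Proof.
move=> w; rewrite /word_inv map_rev revK -map_comp -[RHS]map_id.
by apply: eq_map => -[x b] /=; rewrite negbK.
Qed.

Definition pres_mul (p q : pres_group) := wclass (wrepr p ++ wrepr q).
Definition pres_inv (p : pres_group) := wclass (word_inv (wrepr p)).

Lemma wclassM u v : pres_mul (wclass u) (wclass v) = wclass (u ++ v).
Proof. by apply/wclassP/word_eq_cat; apply: wrepr_wclass. Qed.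

Lemma pres_mulA : associative pres_mul.
Proof.
move=> p q s; rewrite -(wreprK p) -(wreprK q) -(wreprK s).
by rewrite !wclassM catA.
Qed.

Lemma pres_mul1 : left_id (wclass [::]) pres_mul.
Proof. by move=> p; rewrite -(wreprK p) wclassM. Qed.

Lemma pres_mulr1 : right_id (wclass [::]) pres_mul.
Proof. by move=> p; rewrite -(wreprK p) wclassM cats0. Qed.

Lemma pres_mulrV : right_inverse (wclass [::]) pres_inv pres_mul.
Proof.
move=> p; rewrite -{1}(wreprK p) wclassM; apply/wclassP.
exact: word_invr.
Qed.

Lemma pres_mulV : left_inverse (wclass [::]) pres_inv pres_mul.
Proof.
move=> p; rewrite -{2}(wreprK p) wclassM; apply/wclassP.
by rewrite -{2}(word_invK (wrepr p)); apply: word_invr.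
Qed.

HB.instance Definition _ := isGroup.Build pres_group
  pres_mulA pres_mul1 pres_mulr1 pres_mulV pres_mulrV.

Definition pres_gen (x : X) : pres_group := wclass [:: (x, false)].

Lemma eval_pres_gen w : eval_word pres_gen w = wclass w.
Proof.
rewrite /eval_word; elim: w => [|[x b] w IHw]; first by rewrite big_nil.
rewrite big_cons IHw -[in RHS]cat1s -[in RHS]wclassM; congr (_ * _).
case: b => //=; apply: (mulIg (pres_gen x)); rewrite mulVg.
by rewrite [RHS]wclassM; apply/esym/wclassP/(word_eq_cancel R x true).
Qed.

Lemma eval_pres_gen_rel u v :
  R u v -> eval_word pres_gen u = eval_word pres_gen v.
Proof. by move=> Ruv; rewrite !eval_pres_gen; apply/wclassP/word_eq_rel. Qed.

Lemma eval_word_cat (G : groupType) (f : X -> G) u v :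
  eval_word f (u ++ v) = eval_word f u * eval_word f v.
Proof. exact: big_cat. Qed.

Section Induced.
Variables (G : groupType) (f : X -> G).
Hypothesis fR : forall u v, R u v -> eval_word f u = eval_word f v.

Lemma eval_word_eq u v : word_eq R u v -> eval_word f u = eval_word f v.
Proof.
elim=> {u v}.
- exact: fR.
- move=> x b; rewrite /eval_word !big_cons !big_nil mulg1 /=.
  by case: b; rewrite /= (mulVg, mulgV).
- by [].
- by [].
- by move=> u v w _ -> _ ->.
- by move=> u u' v v' _ IHu _ IHv; rewrite !eval_word_cat IHu IHv.
Qed.

Definition pres_hom (q : pres_group) : G := eval_word f (wrepr q).

Lemma pres_hom_wclass w : pres_hom (wclass w) = eval_word f w.
Proof. exact/eval_word_eq/wrepr_wclass. Qed.

Lemma pres_homM : {morph pres_hom : p q / p * q}.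
Proof. by move=> p q; rewrite -[RHS]eval_word_cat -pres_hom_wclass. Qed.

Lemma pres_hom_gen x : pres_hom (pres_gen x) = f x.
Proof. by rewrite pres_hom_wclass /eval_word big_seq1. Qed.

(** That [f] respects [R] gives one half of the equivalence in [presents]; a trivial kernel makes
    the induced homomorphism injective on classes of words, which is the other half. *)
Lemma presents_bij :
  (forall g, exists q, pres_hom q = g) ->
  (forall q, pres_hom q = 1 -> q = 1) -> presents R f.
Proof.
move=> surj inj; split=> [g|u v]; first by have [q <-] := surj g; exists (wrepr q).
split=> [|euv]; first exact: eval_word_eq.
have injF p q : pres_hom p = pres_hom q -> p = q.
  move=> epq; rewrite -[p](mulgVK q) [p * q^-1]inj ?mul1g //.
  by apply: (mulIg (pres_hom q)); rewrite mul1g -pres_homM mulgVK.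
by apply/wclassP/injF; rewrite !pres_hom_wclass.
Qed.

End Induced.
End PresentedGroup.

(** * Coset enumeration from the relations *)

Lemma mulg_exchangeV (G : groupType) (x x' y : G) :
  (x * y = y * x' -> x' * y^-1 = y^-1 * x)%g.
Proof. by move=> xy; apply: (mulgI y); rewrite mulVKg mulgA -xy mulgK. Qed.

Section Cosets.
Local Open Scope group_scope.
Variables (n e r : nat) (G : groupType) (z : G) (t : 'Z_n -> G) (s : nat -> G).
Hypotheses
  (sC : forall j k, 3 <= j -> j + 2 <= k <= r -> s j * s k = s k * s j)
  (sB : forall j, 3 <= j < r -> s j * s j.+1 * s j = s j.+1 * s j * s j.+1)
  (tt : forall i j, t i * t (i - 1)%R = t j * t (j - 1)%R)
  (s3t : forall i, 3 <= r -> s 3 * t i * s 3 = t i * s 3 * t i)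
  (st : forall j i, 4 <= j <= r -> s j * t i = t i * s j)
  (zt : forall i, z * t i = t (i - e%:R)%R * z)
  (zs : forall j, 3 <= j <= r -> z * s j = s j * z)
  (t2 : forall i, t i * t i = 1)
  (s2 : forall j, 3 <= j <= r -> s j * s j = 1).

(* In G(de,e,r) this is the subgroup G(de,e,m) acting on the first m
   coordinates; in particular only powers of z are left for m = 1. *)
Inductive gen_upto (m : nat) : G -> Prop :=
| gen_upto_one : gen_upto m 1
| gen_upto_z g of gen_upto m g : gen_upto m (z * g)
| gen_upto_t i g of 2 <= m & gen_upto m g : gen_upto m (t i * g)
| gen_upto_s j g of 3 <= j <= m & gen_upto m g : gen_upto m (s j * g).

Lemma gen_uptoM m g h : gen_upto m g -> gen_upto m h -> gen_upto m (g * h).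
Proof.
move=> gg gh; elim: gg => [|g' _ IH|i g' m2 _ IH|j g' jm _ IH].
- by rewrite mul1g.
- by rewrite -mulgA; apply: gen_upto_z.
- by rewrite -mulgA; apply: gen_upto_t.
- by rewrite -mulgA; apply: gen_upto_s.
Qed.

Lemma gen_upto_sub m m' g : m <= m' -> gen_upto m g -> gen_upto m' g.
Proof.
move=> mm'; elim=> [|g' _ IH|i g' m2 _ IH|j g' jm _ IH].
- exact: gen_upto_one.
- exact: gen_upto_z.
- by apply: gen_upto_t => //; lia.
- by apply: gen_upto_s => //; lia.
Qed.

Lemma gen_uptoX m g k : gen_upto m g -> gen_upto m (g ^+ k).
Proof.
move=> gg; elim: k => [|k IH]; first exact: gen_upto_one.
by rewrite expgS; apply: gen_uptoM.
Qed.

Lemma mem_gen_z m : gen_upto m z.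
Proof. by rewrite -[z]mulg1; apply/gen_upto_z/gen_upto_one. Qed.
Lemma mem_gen_t m i : 2 <= m -> gen_upto m (t i).
Proof. by move=> m2; rewrite -[t i]mulg1; apply/gen_upto_t/gen_upto_one. Qed.
Lemma mem_gen_s m j : 3 <= j <= m -> gen_upto m (s j).
Proof. by move=> m2; rewrite -[s j]mulg1; apply/gen_upto_s/gen_upto_one. Qed.

Lemma gen_upto1P g : gen_upto 1 g -> exists k, g = z ^+ k.
Proof.
elim=> [|g' _ [k ->]|i g' //|j g' ]; [by exists 0|by exists k.+1; rewrite expgS|].
by lia.
Qed.

(* As a matrix, sprod m maps the m-th basis vector to the second one. *)
Definition sprod (m : nat) : G := \prod_(3 <= i < m.+1) s i.

Lemma sprod2 : sprod 2 = 1.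
Proof. by rewrite /sprod big_geq. Qed.
Lemma sprodS m : 2 <= m -> sprod m.+1 = sprod m * s m.+1.
Proof. by move=> m2; rewrite /sprod big_nat_recr. Qed.

Lemma mem_gen_u m : gen_upto m (sprod m).
Proof.
elim: m => [|m IH]; first by rewrite /sprod big_geq //; apply: gen_upto_one.
case: (leqP 2 m) => m2; last by rewrite /sprod big_geq //; apply: gen_upto_one.
rewrite sprodS //; apply: gen_uptoM; first exact: gen_upto_sub IH.
by apply: mem_gen_s; lia.
Qed.

Lemma tV i : (t i)^-1 = t i.
Proof. by apply: (mulgI (t i)); rewrite mulgV t2. Qed.

Lemma sV j : 3 <= j <= r -> (s j)^-1 = s j.
Proof. by move=> jr; apply: (mulgI (s j)); rewrite mulgV s2. Qed.

Lemma mem_gen_uV m : m <= r -> gen_upto m (sprod m)^-1.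
Proof.
elim: m => [|m IH] mr; first by rewrite /sprod big_geq // invg1; apply: gen_upto_one.
case: (leqP 2 m) => m2; last by rewrite /sprod big_geq // invg1; apply: gen_upto_one.
rewrite sprodS // invgM sV; last by lia.
by apply: gen_uptoM; [apply: mem_gen_s; lia|apply: gen_upto_sub (IH _); lia].
Qed.

(* t_i t_(i-1) is the same element x for all i, whence t_i = x t_(i-1)
   = t_(i-1) x^-1. *)
Lemma ttB1 i k : t i * t k = t (i - 1)%R * t (k - 1)%R.
Proof.
have ti : t i = t (i - 1)%R * (t k * t (k - 1)%R)^-1.
  by rewrite (tt k i) invgM !tV mulgA t2 mul1g.
by rewrite {1}ti invgM !tV -!mulgA t2 mulg1.
Qed.

Lemma ttB i k j : t i * t k = t (i - j)%R * t (k - j)%R.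
Proof.
rewrite -[j]natr_Zp; elim: (nat_of_ord j) i k => [|m IH] i k.
  by rewrite !subr0.
by rewrite IH ttB1 -natr1 !opprD !addrA.
Qed.

Lemma tt_diff i k : t i * t k = t (i - k)%R * t 0%R.
Proof. by rewrite (ttB i k k) subrr. Qed.

(** Since [t k * t 0] equals [t i * t (i - k)], the braid relation between [s 3] and the [t]s
    reduces both sides to [s 3 * t i * s 3 * t (i - k)]. *)
Lemma st3_comm i k : 3 <= r ->
  t i * s 3 * t k * t 0%R = s 3 * t k * t 0%R * s 3 * t (i - k)%R * s 3.
Proof.
move=> r3; have tkt0 : t k * t 0%R = t i * t (i - k)%R.
  by rewrite (tt_diff i) subKr.
rewrite -!(mulgA _ (t k)) tkt0 !mulgA.
have -> : s 3 * t i * t (i - k)%R * s 3 * t (i - k)%R * s 3 =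
          s 3 * t i * (t (i - k)%R * s 3 * t (i - k)%R) * s 3 by rewrite !mulgA.
by rewrite -s3t // !mulgA s3t // -!mulgA s2 ?mulg1 ?leqnn.
Qed.

Lemma s_u_far i m : 2 <= m -> m + 2 <= i <= r -> s i * sprod m = sprod m * s i.
Proof.
elim: m => // m IH; rewrite leq_eqVlt => /predU1P[m1 _|m2 mr].
  by rewrite -m1 sprod2 mulg1 mul1g.
rewrite sprodS // mulgA IH; [|lia|lia].
by rewrite -!mulgA (@sC m.+1 i) //; lia.
Qed.

(** [s i] passes the letters up to [s (i - 2)], a braid relation turns [s i * s i.-1 * s i] into
    [s i.-1 * s i * s i.-1], and the last [s i.-1] commutes with [s i.+1], ..., [s m]. *)
Lemma s_u i m : 4 <= i <= m -> m <= r -> s i * sprod m = sprod m * s i.-1.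
Proof.
case: i => // i; elim: m => [|m IH]; first by lia.
move=> /andP[i4 im] mr; rewrite sprodS; last by lia.
move: im; rewrite leq_eqVlt => /predU1P[[im]|im]; last first.
  rewrite mulgA IH /=; [|lia|lia].
  by rewrite -!mulgA sC //; lia.
rewrite -im in mr *; case: i i4 mr {IH im} => // i i4 mr; rewrite sprodS; last by lia.
rewrite mulgA [s _ * (sprod i * _)]mulgA s_u_far; try lia.
by rewrite -!(mulgA (sprod i)) -sB //=; lia.
Qed.

(** As [s 3] is an involution, [s 3 * sprod m] is the product of [s 4], ..., [s m], which all
    commute with [t i]. *)
Lemma su_t i m : 3 <= m <= r -> t i * (s 3 * sprod m) = s 3 * sprod m * t i.
Proof.
elim: m => // m IH /andP[]; rewrite leq_eqVlt => /predU1P[[<-] r3|m3 mr].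
  by rewrite sprodS // sprod2 mul1g s2 ?mulg1 ?mul1g //; lia.
rewrite sprodS; last by lia.
rewrite (mulgA (s 3)) [in LHS]mulgA IH; last by lia.
by rewrite -!mulgA st //; lia.
Qed.

(* The cosets of G(de,e,m-1) in G(de,e,m): the two representatives map the
   m-th basis vector to zeta^-k e_1 and to zeta^k e_j. *)
Inductive coset_form (m : nat) : G -> Prop :=
| coset1 k h of gen_upto m.-1 h : coset_form m (t k * sprod m * h)
| coset2 j k h of 2 <= j <= m & gen_upto m.-1 h :
    coset_form m ((sprod j)^-1 * t k * t 0%R * sprod m * h).

(** [z] commutes with each [sprod j] and with [t k * t 0], whose two indices it shifts alike, and
    passing a single [t k] only changes [k]; so [z] ends up in [h]. *)
Lemma coset_z m g : 2 <= m <= r -> coset_form m g -> coset_form m (z * g).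
Proof.
have zu j : 2 <= j <= r -> z * sprod j = sprod j * z.
  elim: j => // j IH /andP[]; rewrite leq_eqVlt => /predU1P[<- _|j2 jr].
    by rewrite sprod2 mulg1 mul1g.
  rewrite sprodS // mulgA IH; last by lia.
  by rewrite -!mulgA zs //; lia.
move=> m2; case=> [k h gh|j k h j2 gh].
  rewrite !mulgA zt -(mulgA _ z) zu // mulgA -mulgA.
  by apply: coset1; apply: gen_upto_z.
have zuV : z * (sprod j)^-1 = (sprod j)^-1 * z.
  by apply: mulg_exchangeV; rewrite zu //; lia.
have ztt : z * (t k * t 0%R) = t k * t 0%R * z.
  by rewrite mulgA zt -mulgA zt mulgA -ttB.
have -> : z * ((sprod j)^-1 * t k * t 0%R * sprod m * h) =
          (sprod j)^-1 * t k * t 0%R * sprod m * (z * h).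
  rewrite -!mulgA (mulgA z) zuV -mulgA; congr (_ * _).
  rewrite (mulgA (t k)) mulgA ztt -!mulgA; do 2 congr (_ * _).
  by rewrite mulgA zu // -mulgA.
by apply: coset2 => //; apply: gen_upto_z.
Qed.

Lemma coset_t m i g : 2 <= m <= r -> coset_form m g -> coset_form m (t i * g).
Proof.
move=> m2; case=> [k h gh|j k h j2 gh].
  rewrite !mulgA tt_diff; have := @coset2 m 2 (i - k)%R h.
  by rewrite sprod2 invg1 mul1g; apply=> //; lia.
case: (eqVneq j 2) => [->|jn2].
  rewrite sprod2 invg1 mul1g !mulgA tt_diff -(mulgA (t (i - k)%R)) t2 mulg1.
  exact: coset1.
(* For [j >= 3], [t i] commutes with the part [s 4], ..., [s j] of [sprod j]. By [st3_comm] the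
   representative then stays the same and [t (i - k)] enters [h]. *)
have uj : (sprod j)^-1 = (s 3 * sprod j)^-1 * s 3.
  by rewrite invgM mulgVK.
have tu : t i * (s 3 * sprod j)^-1 = (s 3 * sprod j)^-1 * t i.
  by apply: mulg_exchangeV; rewrite su_t //; lia.
have -> : t i * ((sprod j)^-1 * t k * t 0%R * sprod m * h) =
   (sprod j)^-1 * t k * t 0%R * sprod m * (t (i - k)%R * h).
  rewrite uj !mulgA tu; congr (_ * h).
  rewrite -!(mulgA (s 3 * sprod j)^-1) st3_comm; last by lia.
  rewrite -!mulgA; do 4 congr (_ * _); rewrite su_t; last by lia.
  by rewrite !mulgA s2 ?mul1g //; lia.
by apply: coset2 => //; apply: gen_upto_t => //; lia.
Qed.

(** In the second form, [i = j + 1] replaces [j] by [j + 1] and [i = j] replaces it by [j - 1]. In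
    all other cases the representative stays and [h] absorbs a letter: [t k] if [i = 3] in the first
    form, else [s i] or [s i.-1]. *)
Lemma coset_s m i g :
  m <= r -> 3 <= i <= m -> coset_form m g -> coset_form m (s i * g).
Proof.
move=> mr im; case=> [k h gh|j k h j2 gh].
  case: (eqVneq i 3) => [i3|i3].
    have -> : s i * (t k * sprod m * h) = t k * sprod m * (t k * h).
      rewrite i3 !mulgA; congr (_ * h).
      (* Inserting [s 3 * s 3] creates the braid [s 3 * t k * s 3] and leaves [s 3 * sprod m], which
         commutes with [t k]. *)
      have -> : sprod m = s 3 * (s 3 * sprod m) by rewrite mulgA s2 ?mul1g //; lia.
      rewrite mulgA s3t; last by lia.
      by rewrite -!mulgA su_t ?mulgA //; lia.
    by apply: coset1; apply: gen_upto_t => //; lia.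
  rewrite !mulgA st; last by lia.
  rewrite -(mulgA (t k)) s_u; [|lia|lia]; rewrite mulgA -mulgA.
  by apply: coset1; apply: gen_upto_s => //; lia.
have uV a b : s a * sprod j = sprod j * s b -> s b * (sprod j)^-1 = (sprod j)^-1 * s a.
  exact: mulg_exchangeV.
case: (ltngtP i j) => [ij|ij|ij].
(* Passing the inverse of [sprod j] raises the index to [i.+1 >= 4], so the letter commutes with the
   [t]s; passing [sprod m] lowers it back to [i]. *)
- rewrite !mulgA (uV i.+1); last by rewrite s_u //; lia.
  rewrite -(mulgA _ (s _)) st; last by lia.
  rewrite mulgA -(mulgA _ (s _)) st; last by lia.
  rewrite mulgA -(mulgA _ (s _)) s_u; [|lia|lia].
  rewrite mulgA -mulgA; apply: coset2 => //; apply: gen_upto_s => //=; lia.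
- case: (eqVneq i j.+1) => [->|ij1].
    rewrite !mulgA -[s _]sV -?invgM -?sprodS; try lia.
    by apply: coset2 => //; lia.
  rewrite !mulgA (uV i); last by rewrite s_u_far //; lia.
  rewrite -(mulgA _ (s _)) st; last by lia.
  rewrite mulgA -(mulgA _ (s _)) st; last by lia.
  rewrite mulgA -(mulgA _ (s _)) s_u; [|lia|lia].
  rewrite mulgA -mulgA; apply: coset2 => //; apply: gen_upto_s => //=; lia.
- case: j j2 ij {uV} => // j j2 ij; rewrite ij sprodS; last by lia.
  rewrite invgM sV; last by lia.
  rewrite !mulgA s2 ?mul1g; last by lia.
  by apply: coset2 => //; lia.
Qed.

Lemma gen_upto_coset m g : 2 <= m <= r -> gen_upto m g -> coset_form m g.
Proof.
move=> m2; elim=> [|g' _ IH|i g' _ _ IH|j g' jm _ IH].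
(* The identity has the second form with [j = m], [k = 0] and [h = 1]. *)
- have := @coset2 m m 0%R 1; rewrite -(mulgA (sprod m)^-1) t2 !mulg1 mulVg.
  by apply; [lia|apply: gen_upto_one].
- exact: coset_z.
- exact: coset_t.
- by apply: coset_s => //; lia.
Qed.

End Cosets.

Local Open Scope ring_scope.

(** * Action of the generators on the basis vectors *)

Section RootsOfUnity.
Variables (R : fieldType) (n : nat) (zeta : R).
Hypotheses (n_gt1 : (1 < n)%N) (zeta_prim : n.-primitive_root zeta).

Lemma prim_neq0 : zeta != 0.
Proof.
apply: contraTneq (oner_neq0 R) => z0; rewrite negbK -(prim_expr_order zeta_prim).
by rewrite z0 expr0n gtn_eqF // ltnW.
Qed.

Lemma exp_ZpD (i j : 'Z_n) : zeta ^+ (i + j)%R = zeta ^+ i * zeta ^+ j.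
Proof. by rewrite -exprD /= [X in (_ %% X)%N]Zp_cast // prim_expr_mod. Qed.

Lemma exp_ZpN (i : 'Z_n) : zeta ^+ (- i)%R = zeta ^- i.
Proof.
apply: (mulIf (expf_neq0 i prim_neq0)).
by rewrite -exp_ZpD addNr mulVf // expf_neq0 // prim_neq0.
Qed.

Lemma exp_Zp_nat m : zeta ^+ (m%:R : 'Z_n) = zeta ^+ m.
Proof. by rewrite val_Zp_nat // prim_expr_mod. Qed.

Lemma exp_Zp_eq1 (i : 'Z_n) : zeta ^+ i = 1 -> i = 0.
Proof.
move/eqP; rewrite -(prim_order_dvd zeta_prim) => ni; apply: val_inj => /=.
by apply/eqP; rewrite -(@modn_small i n) // -[X in (_ < X)%N](Zp_cast n_gt1).
Qed.

Lemma exp_Zp_root x : x ^+ n = 1 -> exists i : 'Z_n, x = zeta ^+ i.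
Proof.
by case/(prim_rootP zeta_prim) => i ->; exists i%:R; rewrite exp_Zp_nat.
Qed.

End RootsOfUnity.

Section BasisVectors.
Variables (C : fieldType) (r : nat).

(* With rows numbered from 0, as in s_mx. *)
Definition delta (k : nat) : 'cV[C]_r := \col_i (i == k :> nat)%:R.

Lemma mul_delta (A : 'M[C]_r) (i k : 'I_r) : (A *m delta k) i 0 = A i k.
Proof.
rewrite mxE (bigD1 k) //= mxE eqxx mulr1 big1 ?addr0 // => j jk.
by rewrite mxE (negPf (jk : (j != k :> nat))) mulr0.
Qed.

Lemma delta_ext (A B : 'M[C]_r) :
  (forall k, (k < r)%N -> A *m delta k = B *m delta k) -> A = B.
Proof. by move=> AB; apply/matrixP=> i k; rewrite -!mul_delta AB. Qed.

Lemma delta_scale_inj i k a : (i < r)%N -> a *: delta k = delta i -> k = i /\ a = 1.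
Proof.
move=> ir /matrixP/(_ (Ordinal ir) 0); rewrite !mxE eqxx /=.
case: eqP => [->|_]; rewrite ?mulr1 // mulr0 => /eqP.
by rewrite eq_sym oner_eq0.
Qed.

End BasisVectors.
Arguments delta {C r}.

(* Innermost comparisons first: lia is stuck on a comparison with an if. *)
Ltac case_eqn := repeat match goal with
  |- context [@eq_op _ ?x ?y] =>
    lazymatch x with
    | context [if _ then _ else _] => fail
    | _ => case: (x =P y) => /= ?; try lia
    end
  end; lia.

(** The transposition of [a] and [a.+1], on all of [nat]: [s_j] permutes the basis vectors by
    [swp (j - 2)], so relations among the [s_j] become identities of functions. *)
Definition swp (a k : nat) := if k == a then a.+1 else if k == a.+1 then a else k.

Lemma swpC a b k :
  (a + 2 <= b)%N || (b + 2 <= a)%N -> swp a (swp b k) = swp b (swp a k).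
Proof. by rewrite /swp => ab; case_eqn. Qed.

Lemma swpB a k : swp a (swp a.+1 (swp a k)) = swp a.+1 (swp a (swp a.+1 k)).
Proof. by rewrite /swp; case_eqn. Qed.

Lemma swpK a : involutive (swp a).
Proof. by move=> k; rewrite /swp; case_eqn. Qed.

Lemma swp_lt a k r : (a.+1 < r -> k < r -> swp a k < r)%N.
Proof. by rewrite /swp; case_eqn. Qed.

Section Generators.
Variables (C : numClosedFieldType) (r n : nat) (zeta : C).

Lemma z_mx_delta0 e : z_mx r e zeta *m delta 0 = zeta ^+ e *: delta 0.
Proof.
apply/colP=> i; rewrite mul_diag_mx !mxE.
by case: eqP; rewrite ?mulr0.
Qed.

Lemma z_mx_delta e k : (0 < k)%N -> z_mx r e zeta *m delta k = delta k.
Proof.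
move=> k0; apply/colP=> i; rewrite mul_diag_mx !mxE.
by case: eqP => [->|]; rewrite ?mul1r // eq_sym (gtn_eqF k0) mulr0.
Qed.

Lemma s_mx_delta (j : s_index r) k : (k < r)%N ->
  s_mx C j *m delta k = delta (swp (val j - 2) k).
Proof.
move=> kr; apply/colP=> a.
rewrite -[k]/(nat_of_ord (Ordinal kr)) mul_delta !mxE /=; congr (_%:R).
rewrite permE /swp /= -!val_eqE /=; case: j => j /= jr.
by do 4?case: ifP => /=; lia.
Qed.

Hypothesis r_ge2 : (2 <= r)%N.

Lemma t_mx_delta0 i : t_mx r zeta i *m delta 0 = zeta ^+ (i : 'Z_n) *: delta 1.
Proof.
apply/colP=> a; have r0 : (0 < r)%N by lia.
rewrite -[0%N]/(nat_of_ord (Ordinal r0)) mul_delta !mxE /=.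
case: a => [[|[|a]] ar] /=; rewrite ?mulr0 ?mulr1 //.
Qed.

Lemma t_mx_delta1 i : t_mx r zeta i *m delta 1 = zeta ^- (i : 'Z_n) *: delta 0.
Proof.
apply/colP=> a.
rewrite -[1%N]/(nat_of_ord (Ordinal r_ge2)) mul_delta !mxE /=.
case: a => [[|[|a]] ar] /=; rewrite ?mulr0 ?mulr1 //.
Qed.

Lemma t_mx_delta (i : 'Z_n) k :
  (2 <= k < r)%N -> t_mx r zeta i *m delta k = delta k.
Proof.
move=> /andP[k2 kr]; apply/colP=> a.
rewrite -[k]/(nat_of_ord (Ordinal kr)) mul_delta !mxE /=.
by case: k k2 kr => [|[|k]] // _ kr; case: a => [[|[|a]] ar].
Qed.

End Generators.

(** * The product of the nonzero entries as a homomorphism *)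

Section EntryProduct.
Variables (C : numClosedFieldType) (d e r : nat).

(* The product of the nonzero entries when A is monomial *)
Definition entry_prod (A : 'M[C]_r) := \prod_i \sum_j A i j.

Lemma entry_prod_mono (s : 'S_r) v : entry_prod (mono_mx s v) = \prod_i v i.
Proof.
apply: eq_bigr => i _; rewrite (bigD1 (s i)) //= mxE eqxx big1 ?addr0 // => j.
by rewrite mxE eq_sym => /negPf->.
Qed.

Lemma entry_prodM (A B : 'M[C]_r) : in_refl d e A -> in_refl d e B ->
  entry_prod (A *m B) = entry_prod A * entry_prod B.
Proof.
case/in_reflP=> s [v [_ _ _ ->]] /in_reflP[s' [v' [_ _ _ ->]]].
rewrite mono_mxM !entry_prod_mono big_split; congr (_ * _).
by rewrite [RHS](reindex_inj (@perm_inj _ s)).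
Qed.

Lemma in_refl_entry_prod (A : 'M[C]_r) : in_refl d e A -> entry_prod A ^+ d = 1.
Proof. by case/in_reflP=> s [v [_ _ vd ->]]; rewrite entry_prod_mono. Qed.

(** This exhibits G(de,de,r) as the kernel of [entry_prod] on G(de,e,r): the two groups differ only
    in the condition on the product of the entries. *)
Lemma in_refl1E (A : 'M[C]_r) :
  in_refl 1 (d * e) A = in_refl d e A && (entry_prod A == 1).
Proof.
apply/idP/andP=> [/in_reflP|[/in_reflP]] [s [v [v0 vn pv ->]]] => [|/eqP].
  rewrite mul1n expr1 in vn pv; rewrite entry_prod_mono pv eqxx; split=> //.
  by apply/in_reflP; exists s, v; rewrite pv expr1n.
rewrite entry_prod_mono => pv1.
by apply/in_reflP; exists s, v; rewrite mul1n expr1.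
Qed.

Lemma z_mx_mono zeta : z_mx r e zeta =
  mono_mx 1%g (fun a : 'I_r => if a == 0%N :> nat then zeta ^+ e else 1) :> 'M[C]_r.
Proof.
by apply/matrixP=> a b; rewrite !mxE perm1; case: (a == b).
Qed.

Lemma entry_prod_z zeta : (0 < r)%N ->
  entry_prod (z_mx r e zeta : 'M[C]_r) = zeta ^+ e.
Proof.
move=> r0; rewrite z_mx_mono entry_prod_mono (bigD1 (Ordinal r0)) //=.
by rewrite big1 ?mulr1 // => a a0; rewrite (negPf (a0 : a != 0%N :> nat)).
Qed.

End EntryProduct.

(** * Membership of the generators in G(de,e,r) and verification of the relations *)

Section Membership.
Variables (C : numClosedFieldType) (d e r : nat) (zeta : C).
Hypotheses (d_ge2 : (2 <= d)%N) (e_ge1 : (1 <= e)%N) (r_ge2 : (2 <= r)%N).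
Hypothesis zeta_prim : (d * e).-primitive_root zeta.

Let n_gt1 : (1 < d * e)%N. Proof. nia. Qed.
Let zeta_neq0 : zeta != 0 := prim_neq0 n_gt1 zeta_prim.
Let o0 : 'I_r := Ordinal (ltnW r_ge2).
Let o1 : 'I_r := Ordinal r_ge2.

Lemma in_refl_sub (A : 'M[C]_r) : in_refl 1 (d * e) A -> in_refl d e A.
Proof. by rewrite in_refl1E => /andP[]. Qed.

Lemma z_mx_refl : in_refl d e (z_mx r e zeta).
Proof.
apply/in_reflP; exists 1%g.
exists (fun a : 'I_r => if a == 0%N :> nat then zeta ^+ e else 1).
split=> [a|a||].
- by case: ifP; rewrite ?expf_neq0 ?oner_neq0.
- case: ifP; rewrite ?expr1n // -exprM mulnC exprM.
  by rewrite (prim_expr_order zeta_prim) expr1n.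
- rewrite -(@entry_prod_mono _ _ 1%g) -z_mx_mono entry_prod_z; last exact: ltnW.
  by rewrite -exprM mulnC (prim_expr_order zeta_prim).
- exact: z_mx_mono.
Qed.

Lemma t_mx_refl i : in_refl 1 (d * e) (t_mx r zeta (i : 'Z_(d * e))).
Proof.
have zn : zeta ^+ (d * e) = 1 := prim_expr_order zeta_prim.
pose v (a : 'I_r) :=
  if a == o0 then zeta ^- i else if a == o1 then zeta ^+ i else 1.
apply/in_reflP; exists (tperm o0 o1), v; rewrite /v mul1n; split=> [a|a||].
- by do 2?case: ifP; rewrite ?invr_eq0 ?expf_neq0 ?oner_neq0.
- do 2?case: ifP; rewrite ?expr1n // ?exprVn -?exprM mulnC exprM zn expr1n //.
  by rewrite invr1.
- rewrite (bigD1 o0) //= (bigD1 o1) //= big1 => [|a /andP[/negPf-> /negPf->]//].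
  by rewrite mulr1 mulVf ?expr1n // expf_neq0.
- apply/matrixP=> a b; rewrite !mxE permE /= -!val_eqE /=.
  by case: a b => [[|[|a]] ar] [[|[|b]] br] //=; case: eqP.
Qed.

Lemma s_mx_refl j : in_refl 1 (d * e) (s_mx C (j : s_index r)).
Proof.
apply/in_reflP; exists (tperm (Ordinal (s_index_lt1 j)) (Ordinal (s_index_lt2 j))).
exists (fun=> 1); split=> [a|a||]; rewrite ?oner_neq0 ?expr1n ?big1 //.
by apply/matrixP=> a b; rewrite !mxE; case: eqP.
Qed.

Lemma gen_mx_refl (x : refl_gen (d * e) r) : in_refl d e (gen_mx zeta x).
Proof.
by case: x => [|i|j]; [exact: z_mx_refl|exact/in_refl_sub/t_mx_refl|
  exact/in_refl_sub/s_mx_refl].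
Qed.

Definition refl_elt (x : refl_gen (d * e) r) : refl_group C d e r :=
  Sub (gen_mx zeta x) (gen_mx_refl x).

Lemma val_eval_pos (w : seq (refl_gen (d * e) r)) :
  val (eval_word refl_elt (pos_word w)) = \big[mulmx/1%:M]_(x <- w) gen_mx zeta x.
Proof.
rewrite /eval_word /pos_word big_map.
by elim: w => [|x w IH]; rewrite ?big_nil // !big_cons /= -IH.
Qed.

Lemma positive_rel_eval u v : positive_rel u v ->
  eval_word refl_elt (pos_word u) = eval_word refl_elt (pos_word v).
Proof.
(* Comparing both sides on basis vectors turns each relation into a computation with indices and
   powers of [zeta]. *)
move=> uv; apply: val_inj; rewrite !val_eval_pos; apply: delta_ext.
have sd := fun j k => @s_mx_delta C r j k.
have t0 := @t_mx_delta0 C r (d * e) zeta r_ge2.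
have t1 := @t_mx_delta1 C r (d * e) zeta r_ge2.
have td := @t_mx_delta C r (d * e) zeta.
have z0 := @z_mx_delta0 C r zeta e.
have zd := @z_mx_delta C r zeta e.
have D := exp_ZpD n_gt1 zeta_prim.
have N := exp_ZpN n_gt1 zeta_prim.
have Z i : zeta ^+ (i : 'Z_(d * e)) != 0 by rewrite expf_neq0.
have swpr (j : s_index r) k : (k < r)%N -> (swp (val j - 2) k < r)%N.
  by case: j => j jr; apply: swp_lt => /=; lia.
case: uv => [j k jk|j k jk|i j|j i j3|j i j4|i|j||i|j] a ar;
  rewrite ?big_cons ?big_nil /=
  ?mulmx1 ?mul1mx -?mulmxA.
- rewrite !sd ?swpr // swpC //; case: j k jk => [j jr] [k kr] /=; lia.
- rewrite !sd ?swpr // jk; case: j jk => [j /= jr] jk.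
  by have -> : (j.+1 - 2 = (j - 2).+1)%N by [lia]; rewrite swpB.
(* The product [t i * t (i - 1)] scales [delta 0] by [zeta^-1] and [delta 1] by [zeta], whatever [i]
   is. *)
- case: a ar => [|[|a]] ar; last by rewrite !td.
    rewrite !t0 -!scalemxAr !t1 !scalerA -!N -!D.
    by rewrite !(addrAC _ (-1)) !subrr.
  by rewrite !t1 -!scalemxAr !t0 !scalerA -!N -!D !opprB !subrK.
- have r3 : (3 <= r)%N by case: j j3 => /= j jr <-; lia.
  have s3 k : (k < r)%N -> s_mx C j *m delta k = delta (swp 1 k).
    by move=> kr; rewrite sd // j3.
  have s0 := s3 0%N (ltnW r_ge2); have s1 := s3 1%N r_ge2; have s2 := s3 2%N r3.
  have t2 k : t_mx r zeta (k : 'Z_(d * e)) *m delta 2 = delta 2 by rewrite td.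
  rewrite /swp /= in s0 s1 s2.
  case: a ar => [|[|[|a]]] ar.
  - by do ?rewrite (s0, s1, s2, t0, t1, t2, =^~ scalemxAr).
  - do ?rewrite (s0, s1, s2, t0, t1, t2, =^~ scalemxAr).
    by rewrite scalerA mulVf ?scale1r.
  - by do ?rewrite (s0, s1, s2, t0, t1, t2, =^~ scalemxAr).
  - by rewrite td // s3 //= td // s3.
(* For [j >= 4] the transposition fixes the indices 0 and 1, the only ones that [t i] moves. *)
- have [m m2 smd] : exists2 m, (2 <= m)%N & forall k, (k < r)%N ->
      s_mx C j *m delta k = delta (swp m k) /\ (swp m k < r)%N.
    exists (val j - 2)%N; first by case: j j4 => /= j jr ?; lia.
    by move=> k kr; rewrite swpr // sd.
  case: a ar => [|[|a]] ar.
  - have [[s0 _] [s1 _]] := (smd 0%N ar, smd 1%N r_ge2).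
    rewrite s0 t0 -scalemxAr s1; have -> : swp m 0 = 0%N by rewrite /swp; case_eqn.
    by rewrite t0; congr (_ *: delta _); rewrite /swp; case_eqn.
  - have [[s0 _] [s1 _]] := (smd 0%N (ltnW r_ge2), smd 1%N ar).
    rewrite s1 t1 -scalemxAr s0; have -> : swp m 1 = 1%N by rewrite /swp; case_eqn.
    by rewrite t1; congr (_ *: delta _); rewrite /swp; case_eqn.
  - have [sa ma] := smd _ ar; rewrite td // sa td // ma.
    by rewrite /swp; case_eqn.
(* The factor [zeta ^+ e] that [z] puts on [delta 0] makes up for the shift of the index of [t] by
   [e]. *)
- case: a ar => [|[|a]] ar; last by rewrite zd // !td // zd.
    rewrite t0 z0 -!scalemxAr zd // t0 scalerA; congr (_ *: _).
    by rewrite -(exp_Zp_nat n_gt1 zeta_prim e) -D addrCA subrr addr0.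
  rewrite t1 zd // -!scalemxAr t1 z0 scalerA; congr (_ *: _).
  by rewrite -(exp_Zp_nat n_gt1 zeta_prim e) -!N -!D opprB addrC.
- case: a ar => [|a] ar.
    have s0 : s_mx C j *m delta 0 = delta 0.
      by rewrite sd // /swp; congr delta; case: j => j /= jr; case_eqn.
    by rewrite s0 z0 -scalemxAr s0.
  rewrite zd // sd // zd //; case: j => j /= jr; rewrite /swp; case_eqn.
- case: a ar => [|a] ar.
    have zX k : \big[mulmx/1%:M]_(x <- nseq k (@Gz (d * e) r)) gen_mx zeta x
                *m delta 0 = zeta ^+ (e * k) *: delta 0.
      elim: k => [|k IH]; first by rewrite big_nil mul1mx muln0 scale1r.
      by rewrite /= big_cons -mulmxA IH -scalemxAr z0 scalerA -exprD mulnS addnC.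
    by rewrite zX mulnC (prim_expr_order zeta_prim) scale1r.
  have zX k : \big[mulmx/1%:M]_(x <- nseq k (@Gz (d * e) r)) gen_mx zeta x
              *m delta a.+1 = delta a.+1.
    elim: k => [|k IH]; first by rewrite big_nil mul1mx.
    by rewrite /= big_cons -mulmxA IH /= zd.
  exact: zX.
- case: a ar => [|[|a]] ar; last by rewrite !td.
    by rewrite t0 -scalemxAr t1 scalerA mulfV ?scale1r.
  by rewrite t1 -scalemxAr t0 scalerA mulVf ?scale1r.
- by rewrite !sd ?swpr // swpK.
Qed.
End Membership.

(** * The presentation *)

Section Relations.
Local Open Scope group_scope.
Variables (d e r : nat).
Let P := pres_group (@refl_rel d e r).
Let pgen : refl_gen (d * e) r -> P := @pres_gen _ _.

Definition gz : P := pgen Gz.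
Definition gt i : P := pgen (Gt i).
(** Extended by 1 to indices outside 3, ..., r, because the coset enumeration indexes the [s_j] by
    [nat]. *)
Definition gs (j : nat) : P := if insub j is Some j' then pgen (Gs j') else 1.

Lemma gsE (j : s_index r) : gs (val j) = pgen (Gs j).
Proof. by rewrite /gs valK. Qed.

Lemma gs_index j : (3 <= j <= r)%N ->
  exists2 j' : s_index r, val j' = j & gs j = pgen (Gs j').
Proof. by move=> jr; exists (Sub j jr : s_index r) => //; rewrite -gsE SubK. Qed.

Lemma pgen_rel u v :
  positive_rel u v -> \prod_(x <- u) pgen x = \prod_(x <- v) pgen x.
Proof.
have eval_pos w : eval_word pgen (pos_word w) = \prod_(x <- w) pgen x.
  by rewrite /eval_word big_map.
move=> uv; rewrite -!eval_pos; apply: eval_pres_gen_rel.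
by exists u, v.
Qed.

Lemma gs_comm j k : (3 <= j)%N -> (j + 2 <= k <= r)%N -> gs j * gs k = gs k * gs j.
Proof.
move=> j3 jk; have [|j' jE ->] := @gs_index j; first by lia.
have [|k' kE ->] := @gs_index k; first by lia.
have := @pgen_rel _ _ (@rel_comm d e r j' k' _).
by rewrite !big_cons !big_nil !mulg1; apply; rewrite jE kE; lia.
Qed.

Lemma gs_braid j :
  (3 <= j < r)%N -> gs j * gs j.+1 * gs j = gs j.+1 * gs j * gs j.+1.
Proof.
move=> j3; have [|j' jE ->] := @gs_index j; first by lia.
have [|k' kE ->] := @gs_index j.+1; first by lia.
have := @pgen_rel _ _ (@rel_braid d e r j' k' _).
by rewrite !big_cons !big_nil !mulg1 !mulgA; apply; rewrite jE kE.
Qed.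

Lemma gt_gt i j : gt i * gt (i - 1)%R = gt j * gt (j - 1)%R.
Proof.
by have := pgen_rel (@rel_tt d e r i j); rewrite !big_cons !big_nil !mulg1.
Qed.

Lemma gs3_gt i : (3 <= r)%N -> gs 3 * gt i * gs 3 = gt i * gs 3 * gt i.
Proof.
move=> r3; have [|j' jE ->] := @gs_index 3; first by lia.
have := pgen_rel (@rel_s3t d e r j' i jE).
by rewrite !big_cons !big_nil !mulg1 !mulgA.
Qed.

Lemma gs_gt j i : (4 <= j <= r)%N -> gs j * gt i = gt i * gs j.
Proof.
move=> jr; have [|j' jE ->] := @gs_index j; first by lia.
have := @pgen_rel _ _ (@rel_st d e r j' i _).
by rewrite !big_cons !big_nil !mulg1; apply; rewrite jE; case/andP: jr.
Qed.

Lemma gz_gt i : gz * gt i = gt (i - e%:R)%R * gz.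
Proof.
by have := pgen_rel (@rel_zt d e r i); rewrite !big_cons !big_nil !mulg1.
Qed.

Lemma gz_gs j : (3 <= j <= r)%N -> gz * gs j = gs j * gz.
Proof.
move=> /gs_index[j' _ ->].
by have := pgen_rel (@rel_zs d e r j'); rewrite !big_cons !big_nil !mulg1.
Qed.

Lemma gt_ord i : gt i * gt i = 1.
Proof.
by have := pgen_rel (@rel_t_ord d e r i); rewrite !big_cons !big_nil !mulg1.
Qed.

Lemma gs_ord j : (3 <= j <= r)%N -> gs j * gs j = 1.
Proof.
move=> /gs_index[j' _ ->].
by have := pgen_rel (@rel_s_ord d e r j'); rewrite !big_cons !big_nil !mulg1.
Qed.

Lemma gz_ord : gz ^+ d = 1.
Proof.
have := pgen_rel (@rel_z_ord d e r); rewrite big_nil => <-.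
have zX k : gz ^+ k = \prod_(x <- nseq k Gz) pgen x; last exact: zX.
by elim: k => [|k IH]; rewrite /= (big_nil, big_cons) // expgS IH.
Qed.

Definition pgenerated := gen_upto gz gt gs.

Lemma pgenerated_coset m g :
  (2 <= m <= r)%N -> pgenerated m g -> coset_form gz gt gs m g.
Proof.
apply: gen_upto_coset.
- exact: gs_comm.
- exact: gs_braid.
- exact: gt_gt.
- exact: gs3_gt.
- exact: gs_gt.
- exact: gz_gt.
- exact: gz_gs.
- exact: gt_ord.
- exact: gs_ord.
Qed.

(** [gen_upto] is built from generators without inverses; the inverse of [gz] is [gz ^+ d.-1], and
    the other generators are involutions. *)
Lemma pgeneratedT (d_gt0 : (0 < d)%N) (r_ge2 : (2 <= r)%N) (g : P) : pgenerated r g.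
Proof.
rewrite -(wreprK g) -eval_pres_gen /eval_word; elim: (wrepr g) => [|[x b] w IH].
  by rewrite big_nil; apply: gen_upto_one.
rewrite big_cons; apply: gen_uptoM => //=; case: x => [|i|j].
- have gen_gz := mem_gen_z gz gt gs r.
  case: b => //; have -> : (pres_gen (@refl_rel d e r) Gz)^-1 = gz ^+ d.-1.
    by apply: (mulgI gz); rewrite mulgV -expgS prednK // gz_ord.
  exact: gen_uptoX.
- have gen_gt := mem_gen_t gz gt gs i r_ge2.
  case: b => //; have <- // : gt i = (gt i)^-1.
  by apply: (mulgI (gt i)); rewrite mulgV gt_ord.
- have jr : (3 <= val j <= r)%N by case: j.
  have gen_gs := mem_gen_s gz gt gs jr.
  rewrite -[pres_gen _ _]gsE.
  case: b => //; have <- // : gs (val j) = (gs (val j))^-1.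
  by apply: (mulgI (gs (val j))); rewrite mulgV gs_ord.
Qed.

End Relations.

(** * Bijectivity of the map from the presented group onto G(de,e,r) *)

Section Faithful.
Variables (C : numClosedFieldType) (d e r : nat) (zeta : C).
Hypotheses (d_ge2 : (2 <= d)%N) (e_ge1 : (1 <= e)%N) (r_ge2 : (2 <= r)%N).
Hypothesis zeta_prim : (d * e).-primitive_root zeta.

Let n_gt1 : (1 < d * e)%N. Proof. nia. Qed.
Let zeta_neq0 : zeta != 0 := prim_neq0 n_gt1 zeta_prim.
Let P := pres_group (@refl_rel d e r).
Let elt := refl_elt d_ge2 e_ge1 r_ge2 zeta_prim.

Lemma refl_rel_eval u v : refl_rel u v -> eval_word elt u = eval_word elt v.
Proof. by case=> u' [v' [uv -> ->]]; apply: positive_rel_eval. Qed.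

Definition rho (g : P) : 'M[C]_r := val (pres_hom elt g).

Lemma rhoM g h : rho (g * h)%g = rho g *m rho h.
Proof. by rewrite /rho (pres_homM refl_rel_eval). Qed.

Lemma rho1 : rho 1%g = 1%:M.
Proof. by rewrite /rho (pres_hom_wclass refl_rel_eval) /eval_word big_nil. Qed.

Lemma rho_z : rho (gz d e r) = z_mx r e zeta.
Proof. by rewrite /rho (pres_hom_gen refl_rel_eval). Qed.

Lemma rho_t i : rho (gt r i) = t_mx r zeta i.
Proof. by rewrite /rho (pres_hom_gen refl_rel_eval). Qed.

Lemma rho_s_delta j k : (3 <= j <= r)%N -> (k < r)%N ->
  rho (gs d e r j) *m delta k = delta (swp (j - 2) k).
Proof.
move=> /(@gs_index d e)[j' <- ->] kr.
by rewrite /rho (pres_hom_gen refl_rel_eval) /= s_mx_delta.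
Qed.

Lemma rhoK g (x : 'cV_r) : rho g^-1%g *m (rho g *m x) = x.
Proof. by rewrite mulmxA -rhoM mulVg rho1 mul1mx. Qed.

(** The generators allowed in [pgenerated m] move only basis vectors of index below [m]; [m] is
    positive since [z] is always allowed and scales [delta 0]. *)
Lemma rho_fix m k g : (0 < m <= k)%N -> (k < r)%N -> pgenerated m g ->
  rho g *m delta k = delta k.
Proof.
move=> mk kr; elim=> [|g' _ IH|i g' m2 _ IH|j g' jm _ IH].
- by rewrite rho1 mul1mx.
- by rewrite rhoM -mulmxA IH rho_z z_mx_delta //; lia.
- by rewrite rhoM -mulmxA IH rho_t t_mx_delta //; lia.
- rewrite rhoM -mulmxA IH rho_s_delta //; last by lia.
  by congr delta; rewrite /swp; case_eqn.
Qed.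

Let u := sprod (gs d e r).

Lemma rho_u m : (2 <= m <= r)%N -> rho (u m) *m delta m.-1 = delta 1.
Proof.
elim: m => // m IH /andP[]; rewrite leq_eqVlt => /predU1P[<- _|m2 mr].
  by rewrite /u sprod2 rho1 mul1mx.
rewrite /u sprodS // rhoM -mulmxA rho_s_delta //; last by lia.
have -> : swp (m.+1 - 2) m.+1.-1 = m.-1 by rewrite /swp; case_eqn.
by apply: IH; lia.
Qed.

Lemma rho_coset1 m i : (2 <= m <= r)%N ->
  rho (gt r i * u m)%g *m delta m.-1 = zeta ^- i *: delta 0.
Proof. by move=> mr; rewrite rhoM -mulmxA rho_u // rho_t t_mx_delta1. Qed.

Lemma rho_coset2 m j i : (2 <= j <= m)%N -> (m <= r)%N ->
  rho ((u j)^-1 * gt r i * gt r 0 * u m)%g *m delta m.-1 =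
  zeta ^+ i *: delta j.-1.
Proof.
move=> jm mr; rewrite !rhoM -!mulmxA rho_u; last by lia.
rewrite !rho_t t_mx_delta1 // expr0 invr1 scale1r t_mx_delta0 // -scalemxAr.
by rewrite -(@rho_u j) ?rhoK //; lia.
Qed.

Lemma rho_z_exp k : rho (gz d e r ^+ k)%g *m delta 0 = zeta ^+ (e * k) *: delta 0.
Proof.
elim: k => [|k IH]; first by rewrite rho1 mul1mx muln0 scale1r.
rewrite expgS rhoM -mulmxA IH -scalemxAr rho_z z_mx_delta0 scalerA -exprD.
by rewrite mulnS addnC.
Qed.

Lemma gen_inj m g : (1 <= m <= r)%N -> pgenerated m g -> rho g = 1%:M -> g = 1%g.
Proof.
elim: m g => // m IH g /andP[_ mr] gg rg.
case: m => [|m] in IH mr gg *.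
  (* In the cyclic case [zeta ^+ (e * k) = 1] forces [d] to divide [k]. *)
  have [k gE] := gen_upto1P gg; have := rho_z_exp k; rewrite -gE rg mul1mx => /esym.
  move=> /delta_scale_inj[|_ /eqP]; first by lia.
  rewrite -(prim_order_dvd zeta_prim) [X in (X %| _)%N]mulnC dvdn_pmul2l //.
  by case/dvdnP=> q kE; rewrite gE kE expgnA expgnAC gz_ord expg1n.
have m2 : (2 <= m.+2 <= r)%N by [].
(* [h] fixes [delta m.+1], so a trivially acting [g] forces its representative [c] to fix it too. *)
have ru h c : pgenerated m.+1 h -> g = (c * h)%g ->
    rho c *m delta m.+1 = delta m.+1.
  move=> gh gE; have := rg; rewrite gE rhoM => /(congr1 (mulmx^~ (delta m.+1))).
  by rewrite -mulmxA (rho_fix _ _ gh) //= mul1mx.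
case: (pgenerated_coset m2 gg) (ru) rg => [i h gh|j i h jm gh] {}ru rg.
  have := ru _ _ gh erefl; rewrite (@rho_coset1 m.+2) //.
  by case/delta_scale_inj=> //.
have := ru _ _ gh erefl; rewrite (@rho_coset2 m.+2) //.
case/delta_scale_inj=> // jE /(exp_Zp_eq1 n_gt1 zeta_prim) i0.
(* With [j = m.+2] and [i = 0] the representative is 1, so [g] is [h] and lies in the smaller
   subgroup. *)
have {}jE : j = m.+2 by lia.
rewrite jE i0 -(mulgA (u _)^-1%g) gt_ord mulg1 mulVg mul1g in rg *.
by apply: IH => //; lia.
Qed.

Lemma refl_delta (A : refl_group C d e r) k : (k < r)%N ->
  exists i (a : 'Z_(d * e)), (i < r)%N /\ val A *m delta k = zeta ^+ a *: delta i.
Proof.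
move=> kr; have /in_reflP[s [v [_ vn _ ->]]] := valP A.
(* Row [i] of [mono_mx s v] has its nonzero entry in column [s i], so column [k] has it in row
   [s^-1 k]. *)
pose i := (s^-1)%g (Ordinal kr).
have [a va] := exp_Zp_root n_gt1 zeta_prim (vn i).
exists i, a; split=> //; apply/colP=> j.
rewrite -[k]/(nat_of_ord (Ordinal kr)) mul_delta !mxE -va.
rewrite -(inj_eq (@perm_inj _ s^-1)%g) permK -[s^-1%g _]/i -val_eqE.
by case: (j =P i :> nat) => [/val_inj->|]; rewrite ?mulr1 ?mulr0.
Qed.

Lemma gen_surj m (A : refl_group C d e r) : (1 <= m <= r)%N ->
  (forall k, (m <= k < r)%N -> val A *m delta k = delta k) ->
  exists2 g, pgenerated m g & rho g = val A.
Proof.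
elim: m A => // m IH A /andP[_ mr] fixA.
have [i [a [ir Am]]] := refl_delta A mr.
(* If [i] exceeded [m], then [A] would fix [delta i] and so agree on [delta m] and
   [zeta ^+ a *: delta i], contradicting invertibility. *)
have im : (i <= m)%N.
  rewrite leqNgt; apply/negP => mi.
  have uA := in_refl_unit (valP A).
  have : val A *m delta m = val A *m (zeta ^+ a *: delta i).
    by rewrite -scalemxAr (fixA i) ?Am //; lia.
  move/(can_inj (mulKmx uA))/esym/delta_scale_inj.
  by case=> // im _; rewrite im ltnn in mi.
case: m => [|m] in IH mr fixA Am im *.
  have i0 : i = 0%N by [lia]; rewrite {}i0 in Am.
  (* [z_mx] with [a] in place of [e] is the diagonal matrix with first entry [zeta ^+ a]. The
     condition on the entry product then makes [a] a multiple of [e]. *)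
  have AE : val A = z_mx r a zeta.
    apply: delta_ext => -[|k] kr; first by rewrite Am z_mx_delta0.
    by rewrite fixA // z_mx_delta.
  have : entry_prod (val A) ^+ d = 1 by apply: in_refl_entry_prod (valP A).
  rewrite AE entry_prod_z //.
  rewrite -exprM => /eqP; rewrite -(prim_order_dvd zeta_prim).
  rewrite [X in (X %| _)%N]mulnC dvdn_pmul2r ?(ltnW d_ge2) // => /dvdnP[q aE].
  exists (gz d e r ^+ q)%g; first by apply: gen_uptoX; apply: mem_gen_z.
  apply: delta_ext => -[|k] kr.
    by rewrite rho_z_exp z_mx_delta0 [X in zeta ^+ X]mulnC aE.
  by rewrite (@rho_fix 1) ?z_mx_delta //; apply: gen_uptoX; apply: mem_gen_z.
(* It suffices to match [A] on [delta m.+1]: then [c^-1 A] fixes this vector as well, and the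
   induction hypothesis applies to it. *)
have gsur c : pgenerated m.+2 c -> rho c *m delta m.+1 = val A *m delta m.+1 ->
    exists2 g, pgenerated m.+2 g & rho g = val A.
  move=> gc rc; have [|k kr|h gh rh] := IH (pres_hom elt c^-1 * A)%g;
    first by lia.
    rewrite /= -mulmxA -/(rho _).
    case: (eqVneq k m.+1) => [->|km]; first by rewrite -rc rhoK.
    by rewrite fixA -1?{1}(@rho_fix m.+2 k c) ?rhoK //; lia.
  exists (c * h)%g; first exact: gen_uptoM (gen_upto_sub _ gh).
  by rewrite rhoM rh /= -/(rho _) mulmxA -rhoM mulgV rho1 mul1mx.
have gen_um : pgenerated m.+2 (u m.+2) by apply: mem_gen_u.
case: i => [|i] in ir Am im *.
  (* The index is [- a] because [t_k u_m] produces the factor [zeta ^- k]. *)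
  apply: (gsur (gt r (- a) * u m.+2)%g); first by apply: gen_upto_t.
  by rewrite (@rho_coset1 m.+2) // Am (exp_ZpN n_gt1 zeta_prim) invrK.
apply: (gsur ((u i.+2)^-1 * gt r a * gt r 0 * u m.+2)%g); last first.
  by rewrite (@rho_coset2 m.+2) // Am.
apply: gen_uptoM gen_um; do 2![apply: gen_uptoM; last exact: mem_gen_t].
apply: (@gen_upto_sub _ _ _ _ _ i.+2); first by lia.
by apply: (@mem_gen_uV _ r); [apply: gs_ord|lia].
Qed.

Lemma refl_presents : presents (@refl_rel d e r) elt.
Proof.
apply: presents_bij => [|A|q rq].
- exact: refl_rel_eval.
- have [||g _ rg] := @gen_surj r A; first by lia.
    by move=> k; lia.
  by exists g; apply: val_inj.
- apply: (@gen_inj r); first by lia.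
  + by apply: pgeneratedT => //; lia.
  + by rewrite /rho rq.
Qed.
End Faithful.

(** * The semidirect product *)

Section SemidirectDecomposition.
Variables (C : numClosedFieldType) (d e r : nat) (zeta : C).
Hypotheses (d_ge2 : (2 <= d)%N) (e_ge1 : (1 <= e)%N) (r_ge2 : (2 <= r)%N).
Hypothesis zeta_prim : (d * e).-primitive_root zeta.

Let elt := refl_elt d_ge2 e_ge1 r_ge2 zeta_prim.
Let zelt : refl_group C d e r := elt Gz.
Notation N := (refl_group C 1 (d * e) r).

Definition incl (A : N) : refl_group C d e r := Sub (val A) (in_refl_sub (valP A)).

Lemma incl_inj : injective incl.
Proof. by move=> A B /(congr1 val) /= /val_inj. Qed.

Lemma inclM A B : incl (A * B)%g = (incl A * incl B)%g.
Proof. exact: val_inj. Qed.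

Lemma incl1 : incl 1%g = 1%g.
Proof. exact: val_inj. Qed.

Definition eprod (A : refl_group C d e r) : C := entry_prod (val A).

Lemma eprodM A B : eprod (A * B)%g = eprod A * eprod B.
Proof. exact: (entry_prodM (valP A) (valP B)). Qed.

Lemma eprod1 : eprod 1%g = 1.
Proof.
by rewrite /eprod -[val _]/(1%:M) -mono_mx1 entry_prod_mono big1.
Qed.

Lemma eprod_incl A : eprod (incl A) = 1.
Proof.
by have := valP A; rewrite /= in_refl1E => /andP[_ /eqP].
Qed.

Lemma incl_eprod1 A : eprod A = 1 -> exists B, incl B = A.
Proof.
move=> A1; have inA : in_refl 1 (d * e) (val A).
  by rewrite in_refl1E (valP A) -[entry_prod _]/(eprod A) A1 eqxx.
by exists (Sub (val A) inA); apply: val_inj.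
Qed.

(** As [zeta ^+ e] is the entry product of [z], the entry product maps the powers of [z] onto all
    d-th roots of unity and separates exponents modulo [d]. *)
Lemma omega_prim : d.-primitive_root (zeta ^+ e).
Proof.
have := dvdn_prim_root zeta_prim (dvdn_mulr e (dvdnn d)).
by rewrite mulKn // ltnW.
Qed.

Lemma eprod_zX k : eprod (zelt ^+ k)%g = (zeta ^+ e) ^+ k.
Proof.
elim: k => [|k IH]; first exact: eprod1.
rewrite expgS eprodM IH exprS; congr (_ * _).
by rewrite /eprod /= entry_prod_z // ltnW.
Qed.

Lemma zelt_ord : (zelt ^+ d = 1)%g.
Proof.
have := positive_rel_eval d_ge2 e_ge1 r_ge2 zeta_prim (rel_z_ord d e r).
rewrite /eval_word big_nil => <-; rewrite big_map.
have zX k : (zelt ^+ k = \prod_(x <- nseq k Gz) elt x)%g; last exact: zX.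
by elim: k => [|k IH]; rewrite /= (big_nil, big_cons) // expgS IH.
Qed.

(** The additive group ['Z_d] plays the role of the cyclic group generated by [z]; by [zelt_ord],
    reducing exponents modulo [d] is harmless. *)
Definition zpow (h : 'Z_d) : refl_group C d e r := (zelt ^+ h)%g.

Lemma zpowM g h : zpow (g * h)%g = (zpow g * zpow h)%g.
Proof.
rewrite /zpow -expgnDr /= [X in (_ %% X)%N]Zp_cast //.
rewrite [in RHS](divn_eq (g + h) d) expgnDr mulnC expgnA zelt_ord expg1n.
by rewrite mul1g.
Qed.

Lemma zpow1 : zpow 1%g = 1%g. Proof. by []. Qed.

Lemma zpowV_eprod h A : eprod (zpow h * incl A * (zpow h)^-1)%g = 1.
Proof.
by rewrite !eprodM eprod_incl mulr1 -eprodM mulgV eprod1.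
Qed.

(** G(de,de,r) is normal, being the kernel of the entry product. *)
Lemma zact_subproof h A :
  in_refl 1 (d * e) (val (zpow h * incl A * (zpow h)^-1)%g).
Proof.
by case: (incl_eprod1 (zpowV_eprod h A)) => B <-; apply: (valP B).
Qed.

Definition zact_fun (h : 'Z_d) (A : N) : N := Sub _ (zact_subproof h A).

Lemma incl_zact h A : incl (zact_fun h A) = (zpow h * incl A * (zpow h)^-1)%g.
Proof. exact: val_inj. Qed.

Lemma zact_fun1 A : zact_fun 1%g A = A.
Proof.
by apply: incl_inj; rewrite incl_zact zpow1 mul1g invg1 mulg1.
Qed.

Lemma zact_funM g h A : zact_fun (g * h)%g A = zact_fun g (zact_fun h A).
Proof.
by apply: incl_inj; rewrite !incl_zact zpowM invgM !mulgA.
Qed.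

Lemma zact_fun_mul h A B : zact_fun h (A * B)%g = (zact_fun h A * zact_fun h B)%g.
Proof.
by apply: incl_inj; rewrite inclM !incl_zact inclM !mulgA mulgVK.
Qed.

Definition zact := AutLact zact_fun1 zact_funM zact_fun_mul.

Definition sd_refl (x : semidirect zact) : refl_group C d e r :=
  (incl (sd_ker x) * zpow (sd_cpl x))%g.

Lemma sd_reflM : {morph sd_refl : x y / (x * y)%g}.
Proof.
move=> [A g] [B h]; rewrite /sd_refl /= zpowM inclM incl_zact.
by rewrite !mulgA mulgVK.
Qed.

HB.instance Definition _ := isMultiplicative.Build _ _ sd_refl sd_reflM.

Lemma eprod_zpow h : eprod (zpow h) = (zeta ^+ e) ^+ h.
Proof. exact: eprod_zX. Qed.

(** The entry product is 1 on the factor from G(de,de,r), so it recovers the exponent of [z]; the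
    power of [z] then cancels. *)
Lemma sd_refl_inj : injective sd_refl.
Proof.
move=> [A g] [B h]; rewrite /sd_refl /= => AB.
have gh : g = h.
  have := congr1 eprod AB; rewrite !eprodM !eprod_incl !mul1r !eprod_zpow.
  move/eqP; rewrite (eq_prim_root_expr omega_prim).
  rewrite !modn_small => [/eqP/val_inj //||].
    by rewrite -[X in (_ < X)%N](Zp_cast d_ge2).
  by rewrite -[X in (_ < X)%N](Zp_cast d_ge2).
by move: AB; rewrite gh => /mulIg/incl_inj ->.
Qed.

(** The entry product of [A] equals that of some power of [z], and dividing by this power leads into
    the kernel. The equation is boolean so that [xchoose] can build the inverse map. *)
Lemma sd_refl_surj A : exists x, sd_refl x == A.
Proof.
have [h Ah] := exp_Zp_root d_ge2 omega_prim (in_refl_entry_prod (valP A)).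
have [|B BE] := @incl_eprod1 (A * (zpow h)^-1)%g.
  rewrite eprodM [eprod A]Ah -eprod_zpow -eprodM mulgV; exact: eprod1.
by exists (SemiDirect zact B h); rewrite /sd_refl /= BE mulgVK.
Qed.

Lemma sd_refl_bij : bijective sd_refl.
Proof.
exists (fun A => xchoose (sd_refl_surj A)) => x; last first.
  exact/eqP/(xchooseP (sd_refl_surj x)).
by apply: sd_refl_inj; apply/eqP/(xchooseP (sd_refl_surj (sd_refl x))).
Qed.

Definition tN i : N :=
  Sub (t_mx r zeta i) (t_mx_refl d_ge2 e_ge1 r_ge2 zeta_prim i).
Definition sN j : N := Sub (s_mx C j) (@s_mx_refl C d e r j).

Lemma zpow_gen : zpow 1%R = zelt.
Proof. by rewrite /zpow /= modn_small. Qed.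

Lemma sd_refl_ker g : sd_refl (SemiDirect zact g 1%g) = incl g.
Proof. by rewrite /sd_refl zpow1 mulg1. Qed.

Lemma sd_refl_cpl : sd_refl (SemiDirect zact 1%g 1%R) = zelt.
Proof. by rewrite /sd_refl zpow_gen incl1 mul1g. Qed.

(** Turns the relations of [z] with the [t_i] and [s_j], already verified in G(de,e,r), into
    formulas for the action. *)
Lemma zact_conj A B : (zelt * incl A = incl B * zelt)%g -> zact 1%R A = B.
Proof.
by move=> zA; apply: incl_inj; rewrite incl_zact zpow_gen zA mulgK.
Qed.

Lemma zact_tN i : zact 1%R (tN i) = tN (i - e%:R).
Proof.
apply: zact_conj.
have := positive_rel_eval d_ge2 e_ge1 r_ge2 zeta_prim (rel_zt r i).
rewrite /eval_word !big_cons !big_nil !mulg1 => E.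
by apply: val_inj; have := congr1 val E.
Qed.

Lemma zact_sN j : zact 1%R (sN j) = sN j.
Proof.
apply: zact_conj.
have := positive_rel_eval d_ge2 e_ge1 r_ge2 zeta_prim (@rel_zs d e r j).
rewrite /eval_word !big_cons !big_nil !mulg1 => E.
by apply: val_inj; have := congr1 val E.
Qed.

End SemidirectDecomposition.

(* The group law of 'Z_d is addition, so 1%R : 'Z_d is the generator z of the
   cyclic group of order d and 1%g : 'Z_d is its identity. *)
Theorem corollary3p4 (C : numClosedFieldType) (d e r : nat)
    (d_ge2 : (2 <= d)%N) (r_ge2 : (2 <= r)%N) (e_ge1 : (1 <= e)%N)
    (zeta : C) (zeta_prim : (d * e).-primitive_root zeta) :
  (exists (t : 'Z_(d * e) -> refl_group C 1 (d * e) r)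
          (s : s_index r -> refl_group C 1 (d * e) r),
     (forall i, val (t i) = t_mx r zeta i) /\
     (forall j, val (s j) = s_mx C j) /\
     exists a : aut_lact 'Z_d (refl_group C 1 (d * e) r),
       (forall i, a (1%R : 'Z_d) (t i) = t (i - e%:R)) /\
       (forall j, a (1%R : 'Z_d) (s j) = s j) /\
       exists phi : {multiplicative semidirect a -> refl_group C d e r},
         bijective phi /\
         (forall g, val (phi (SemiDirect a g 1%g)) = val g) /\
         val (phi (SemiDirect a 1%g (1%R : 'Z_d))) = z_mx r e zeta) /\
  (exists f : refl_gen (d * e) r -> refl_group C d e r,
     (forall x, val (f x) = gen_mx zeta x) /\
     presents (@refl_rel d e r) f).
Proof.
split; last first.
  exists (refl_elt d_ge2 e_ge1 r_ge2 zeta_prim); split=> //.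
  exact: refl_presents.
exists (tN d_ge2 e_ge1 r_ge2 zeta_prim), (@sN C d e r).
split=> //; split=> //; exists (zact d_ge2 e_ge1 r_ge2 zeta_prim).
split; first exact: zact_tN.
split; first exact: zact_sN.
exists (@sd_refl C d e r zeta d_ge2 e_ge1 r_ge2 zeta_prim).
split; first exact: sd_refl_bij.
split=> [g|].
  by have /(congr1 val) := sd_refl_ker d_ge2 e_ge1 r_ge2 zeta_prim g.
by have /(congr1 val) := sd_refl_cpl d_ge2 e_ge1 r_ge2 zeta_prim.
Qed.
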